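(* Let $P\in\mathcal{P}$, $q\in Q$, let $A$ be a vertex of degree 3 in $P$, and let $e_1,e_2,\ldots,e_n$ be the sequence of all consecutive edges of the oriented path $[A,q+1]$ which are adjacent to the path $[A,q]$. Then: (1) if $n>1$, then $[A,q](e_j)=2M(q)F(j)$ for $1\le j\le n$, where $F(j)$, $j\in\mathbb{N}$, is the $\frac{S^+(q)}{M(q)}$-billiard sequence; (2) $n=\dfrac{M(q)}{|S^+(q),M(q)|}$; (3) $K(q+1)=|S^+(q),M(q)|$; (4) $K(q+1)M(q+1)=K(q)M(q)$.
   Context: Graphs are finite and loopless but may have multiple edges. A plane triangulation is a plane graph all of whose faces (including the outer one) are bounded by cycles of length 3. $\mathcal{P}$ is the family of all 2-connected plane triangulations all of whose vertices have degree 3 or 6. $Q=\{0,1,2\}$ is the cyclic group of integers modulo 3. For $P\in\mathcal{P}$ fix a partition of the edge set into three classes indexed by $Q$ such that for every vertex $v$, if two edges are counterclockwise successive edges incident with $v$, then the first is of class $q$ and the second is of class $q+1$ for some $q\in Q$ (such a partition is known to exist, by Grünbaum and Motzkin). A subgraph is of class $q$ if all of its edges are of class $q$. It is known that the spanning subgraph $P_q$ formed by the edges of class $q$ consists of two induced paths (the maximal paths of class $q$, whose ends are the four vertices of degree 3) of the same length, denoted $M(q)$, and of $K(q)-1$ induced cycles of the same length $2M(q)$, where $K(q)$ is the distance in $P$ between the two maximal paths of class $q$. For a vertex $A$ of degree 3, $[A,q]$ denotes the maximal path of class $q$ having $A$ as an end, oriented as $v_0v_1\ldots v_{M(q)}$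 with initial vertex $A=v_0$ and terminal vertex $A_q=v_{M(q)}$. An edge is adjacent to a path if it does not belong to the path but is incident with a vertex of it. An edge $e$ adjacent to $[A,q]$ at the vertex $v_j$ is a left branch of $[A,q]$ if either $0\le j<M(q)$ and $v_jv_{j+1},e$ are counterclockwise successive edges at $v_j$, or $0<j\le M(q)$ and $e,v_{j-1}v_j$ are counterclockwise successive edges at $v_j$; otherwise it is a right branch. Put $[A,q](e)=j$ if $e$ is a left branch and $[A,q](e)=2M(q)-j$ if $e$ is a right branch. Let $A,C$ be ends of the two different maximal paths of class $q$. Let $f$ be the first edge of the oriented path $[C,q+1]$ which is adjacent to $[A,q]$. Then $S^+(q)=[A,q](f)$ if $f$ is a left branch of $[A,q]$ and $S^+(q)=[A,q](f)-M(q)$ if $f$ is a right branch. This value does not depend on the choice of $A$ and $C$, and $0\le S^+(q)<M(q)$. $|s,m|$ denotes the greatest common divisor of integers $s\ge 0$ and $m\ge 1$ (so $|0,m|=m$). For $0<\theta<1$, the $\theta$-billiard sequence is the sequence $F(j)\in[0,1)$, $j\in\mathbb{N}=\{1,2,\ldots\}$, determined by $F(1)=0$, $F(j)+F(j+1)\in\{\theta,1+\theta\}$ for odd $j$, and $F(j)+F(j+1)\in\{0,1\}$ for even $j$. *)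

(* Defs.v *)
From Stdlib Require Import ClassicalEpsilon.
From HB Require Import structures.
From mathcomp Require Import all_boot all_order all_fingroup all_algebra.

Set Implicit Arguments.
Unset Strict Implicit.
Unset Printing Implicit Defensive.

Import Order.TTheory GRing.Theory Num.Theory.

(* A finite multigraph drawn on an oriented surface, given by its rotation
   system.  Every edge is a pair {d, flip d} of opposite darts, and turn d is
   the counterclockwise successor of d among the darts leaving src d. *)
Record rotation_graph := RotationGraph {
  vertex : finType;
  dart : finType;
  src : dart -> vertex;
  flip : {perm dart};
  turn : {perm dart};
  flipK : involutive flip;
  flip_neq : forall d, flip d != d;
  same_src : forall d d', (src d == src d') = (d' \in porbit turn d)
}.

Arguments flip {_}.
Arguments turn {_}.

Section PlaneTriangulations.

Variable G : rotation_graph.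
Implicit Types (v w x : vertex G) (d : dart G).

Definition tgt d : vertex G := src (flip d).

Definition degree v := #|[pred d | src d == v]|.

Definition adj : rel (vertex G) :=
  [rel v w | [exists d, (src d == v) && (tgt d == w)]].

Definition connected := forall v w, connect adj v w.

(* turn^-1 (flip d) follows d on the boundary of the face to the left of d. *)
Definition face : {perm dart G} := (flip * turn^-1)%g.

(* Euler's formula V + F = E + 2: the surface is the sphere.  The choice of
   the outer face plays no role in what follows and is not recorded. *)
Definition plane :=
  connected /\ #|vertex G| + #|porbits face| = #|porbits (@flip G)| + 2.

Definition loopless := forall d, src d != tgt d.

Definition two_connected :=
  [/\ 2 < #|vertex G|, connected
    & forall x v w, v != x -> w != x ->
        connect [rel a b | [&& adj a b, a != x & b != x]] v w].

Definition triangulation :=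
  forall d, #|porbit face d| = 3 /\ {in porbit face d &, injective (@src G)}.

Definition family_P :=
  [/\ plane, loopless, two_connected, triangulation
    & forall v, degree v = 3 \/ degree v = 6].

(* Oriented paths are pairs (v, p): initial vertex and sequence of darts. *)
Fixpoint walk v (p : seq (dart G)) : bool :=
  if p is d :: p' then (src d == v) && walk (tgt d) p' else true.

Definition path_vertices v (p : seq (dart G)) := v :: map tgt p.

(* Edge sets are represented by flip-closed sets of darts. *)
Definition path_edges (p : seq (dart G)) : {set dart G} :=
  [set d | (d \in p) || (flip d \in p)].

Definition is_dist (X Y : seq (vertex G)) (k : nat) :=
  (exists v p, [/\ v \in X, walk v p, last v (map tgt p) \in Y & size p = k])
  /\ (forall v p, v \in X -> walk v p -> last v (map tgt p) \in Y ->
        k <= size p).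

Definition adjacent_edge v (p : seq (dart G)) d : bool :=
  (d \notin path_edges p) &&
  ((src d \in path_vertices v p) || (tgt d \in path_vertices v p)).

(* The orientation of the edge of d that leaves the path (v, p), for an edge
   adjacent to the path; exactly one end of the edge is on the path whenever
   the path is induced. *)
Definition away v (p : seq (dart G)) d : dart G :=
  if src d \in path_vertices v p then d else flip d.

Definition foot v (p : seq (dart G)) d : nat :=
  index (src (away v p d)) (path_vertices v p).

(* With p = [:: d_0; ...; d_(m-1)], d_j is the dart from v_j to v_(j+1), and
   flip d_(j-1) is the edge v_(j-1)v_j seen from v_j. *)
Definition left_branch v (p : seq (dart G)) d : bool :=
  let e := away v p d in
  let j := foot v p d in
  ((j < size p) && (turn (nth e p j) == e))
  || ((0 < j <= size p) && (turn e == flip (nth e p j.-1))).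

Section EdgeClasses.

Variable cls : dart G -> 'Z_3.
Implicit Type q : 'Z_3.

Definition edge_classes :=
  (forall d, cls (flip d) = cls d)
  /\ (forall d, cls (turn d) = (cls d + 1)%R).

Definition class_path q v (p : seq (dart G)) : bool :=
  [&& walk v p, uniq (path_vertices v p) & all (fun d => cls d == q) p].

Definition maximal_path q v (p : seq (dart G)) :=
  class_path q v p /\
  (forall w p', class_path q w p' -> path_edges p \subset path_edges p' ->
     path_edges p' = path_edges p).

(* [A, q]; meaningful when A has degree 3. *)
Definition max_path q (A : vertex G) : seq (dart G) :=
  epsilon (inhabits [::]) (maximal_path q A).

Definition different_max_paths q (A C : vertex G) :=
  [/\ degree A = 3, degree C = 3
    & path_edges (max_path q A) <> path_edges (max_path q C)].

(* M(q), K(q) and S^+(q) are each the common value over all admissible choices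
   of the ends A and C. *)
Definition Mlen q : nat :=
  epsilon (inhabits 0)
    (fun m => forall A, degree A = 3 -> size (max_path q A) = m).

Definition Kdist q : nat :=
  epsilon (inhabits 0)
    (fun k => forall A C, different_max_paths q A C ->
       is_dist (path_vertices A (max_path q A))
               (path_vertices C (max_path q C)) k).

(* [A, q](e) *)
Definition branch_value q (A : vertex G) d : nat :=
  let p := max_path q A in
  if left_branch A p d then foot A p d else 2 * Mlen q - foot A p d.

(* The edges of [C, q + 1] adjacent to [A, q], in the order of [C, q + 1]. *)
Definition adjacent_edges q (A C : vertex G) : seq (dart G) :=
  filter (adjacent_edge A (max_path q A)) (max_path (q + 1)%R C).

Definition Splus q : nat :=
  epsilon (inhabits 0)
    (fun s => forall A C, different_max_paths q A C ->
       exists2 f, ohead (adjacent_edges q A C) = Some f &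
         s = if left_branch A (max_path q A) f then branch_value q A f
             else branch_value q A f - Mlen q).

End EdgeClasses.

End PlaneTriangulations.

(* F 0 is irrelevant: billiard sequences are indexed from 1. *)
Definition billiard_sequence (R : realFieldType) (theta : R) (F : nat -> R) :=
  [/\ (0 < theta < 1)%R,
      forall j, 0 < j -> (0 <= F j < 1)%R,
      F 1 = 0%R,
      forall j, odd j ->
        (F j + F j.+1 = theta)%R \/ (F j + F j.+1 = 1 + theta)%R
    & forall j, 0 < j -> ~~ odd j ->
        (F j + F j.+1 = 0)%R \/ (F j + F j.+1 = 1)%R].

(* Main.v *)
(* The rotation group of the triangular lattice, <r, f | r^6 = f^2 = (f
   r^-1)^3 = 1>, acts on the darts of P, because all degrees divide 6 and all
   faces are triangles. Its translations preserve the classes, so P is a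
   quotient of the triangular lattice by a group of translations and half
   turns. In the coordinates (x, y) along the classes q and q + 1, with origin
   at a vertex of degree 3, two darts of class q coincide exactly when they
   differ by an element of 2L, and two vertices exactly when they agree up to
   sign modulo 2L, where L is the lattice of the vertices of degree 3. If (M,
   0), (S, K) is the basis of L in Hermite normal form, then M = M(q), K =
   K(q) and S = S^+(q). Passing from q to q + 1 replaces L by its image under
   a rotation, which gives K(q + 1) = gcd(S, M) and, since the index of L is
   unchanged, K(q + 1) M(q + 1) = K(q) M(q). The path [A, q + 1] is the line x
   = 0; it meets the lines of [A, q] at y = 2iK, and the point (0, 2iK) is
   identified with (- 2iS, 0), whence the billiard sequence. *)

Require Import Defs.
From Stdlib Require Import ClassicalEpsilon.
From mathcomp Require Import all_boot all_order all_fingroup all_algebra.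
From mathcomp Require Import zify ring.

Set Implicit Arguments.
Unset Strict Implicit.
Unset Printing Implicit Defensive.

Import Order.TTheory GRing.Theory Num.Theory.

(** * Integer powers in a finite group *)

Section IntegerPowers.

Local Open Scope group_scope.

Variable gT : finGroupType.
Implicit Types (g h : gT) (x y : int).

Definition zexpg g x : gT :=
  match x with Posz n => g ^+ n | Negz n => g ^- n.+1 end.

Lemma zexpgB g (m n : nat) : zexpg g (m%:Z - n%:Z)%R = g ^+ m * g ^- n.
Proof.
case: (leqP n m) => [le_nm | /ltnW le_mn].
  by rewrite subzn //= -{2}(subnK le_nm) expgD mulgK.
have -> : (m%:Z - n%:Z)%R = (- (n - m)%N%:Z)%R by lia.
rewrite -{2}(subnK le_mn) expgD invMg mulKVg.
by case: (n - m) => [|k]; rewrite ?invg1.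
Qed.

Lemma int_subn_exists x : exists m n : nat, x = (m%:Z - n%:Z)%R.
Proof.
by case: x => n; [exists n, 0%N | exists 0%N, n.+1]; lia.
Qed.

Lemma zexpgD g x y : zexpg g (x + y)%R = zexpg g x * zexpg g y.
Proof.
have [a [b ->]] := int_subn_exists x; have [c [d ->]] := int_subn_exists y.
have -> : (a%:Z - b%:Z + (c%:Z - d%:Z))%R = ((a + c)%N%:Z - (b + d)%N%:Z)%R.
  by lia.
rewrite !zexpgB (addnC b) !expgD invMg !mulgA; congr (_ * _).
rewrite -!mulgA; congr (_ * _).
by apply: commuteV; apply: commuteX2; apply: commute_refl.
Qed.

Lemma zexpgN g x : zexpg g (- x)%R = (zexpg g x)^-1.
Proof. by apply: (mulIg (zexpg g x)); rewrite -zexpgD addNr mulVg. Qed.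

Lemma zexpg_commute g h x y :
  commute g h -> commute (zexpg g x) (zexpg h y).
Proof.
by move=> gh; case: x => m; case: y => n /=;
  rewrite -?expgVn; apply: commuteX2; do ?[apply: commuteV];
  do ?[apply: commute_sym; apply: commuteV; apply: commute_sym].
Qed.

Lemma zexpgM g h x :
  commute g h -> zexpg (g * h) x = zexpg g x * zexpg h x.
Proof.
by move=> gh; case: x => n /=; rewrite expgMn ?invMg //;
  apply: (@zexpg_commute _ _ (Negz n) (Negz n)); apply: commute_sym.
Qed.

Lemma zexpgV g x : zexpg g^-1 x = zexpg g (- x)%R.
Proof.
rewrite zexpgN; apply: (mulgI (zexpg g x)).
rewrite mulgV -zexpgM ?mulgV; last exact/commuteV/commute_refl.
by case: x => n /=; rewrite ?expg1n ?invg1.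
Qed.

Lemma zexpgJ g h x : zexpg g x ^ h = zexpg (g ^ h) x.
Proof. by case: x => n /=; rewrite ?conjVg conjXg. Qed.

End IntegerPowers.

(* The rotation group of the triangular lattice, generated by the rotation r of
   order 6 about a vertex and the rotation f of order 2 about an edge. *)
Section TriangleGroup.

Local Open Scope group_scope.

Variables (gT : finGroupType) (r f : gT).
Hypotheses (r6 : r ^+ 6 = 1) (ff : f * f = 1) (fr3 : (f * r^-1) ^+ 3 = 1).

(** A product of two half turns is a translation, here by one edge; [u] and [u ^ r^-1] are its
    rotations by one and two sixths of a turn. *)
Let t := f * r ^+ 3.
Let u := t ^ r^-1.

Let fV : f^-1 = f.
Proof. by apply: (mulgI f); rewrite mulgV ff. Qed.

(** The relation [fr3] splits as [(f * r^-1 * f) * (r^-1 * f * r^-1) = 1]. *)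
Lemma triangle_braid : f * r^-1 * f = r * f * r.
Proof.
have: f * r^-1 * f = (r^-1 * f * r^-1)^-1.
  apply: (mulIg (r^-1 * f * r^-1)); rewrite mulVg -fr3 !expgS expg0 mulg1.
  by rewrite ?mulgA.
by rewrite !invMg fV !invgK !mulgA.
Qed.

Lemma triangle_braidV : f * r * f = r^-1 * f * r^-1.
Proof.
by apply: invg_inj; rewrite !invMg fV !invgK !mulgA triangle_braid.
Qed.

Let uE : u = r * f * r ^+ 2.
Proof. by rewrite /u /t conjgE invgK !mulgA mulgK. Qed.

Let wE : u ^ r^-1 = r ^+ 2 * f * r.
Proof. by rewrite uE conjgE invgK !mulgA mulgK. Qed.

Lemma translation_sum : t * u ^ r^-1 = u.
Proof.
rewrite wE uE.
transitivity (f * (r * r * r * r * r) * f * r); first by rewrite /t !mulgA.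
have -> : r * r * r * r * r = r^-1.
  by apply: (mulIg r); rewrite mulVg -r6 !expgS expg0 mulg1 !mulgA.
by rewrite triangle_braid !mulgA.
Qed.

Lemma translation_sum_sym : u ^ r^-1 * t = u.
Proof.
rewrite wE uE.
transitivity (r * r * (f * r * f) * (r * r * r)); first by rewrite /t !mulgA.
by rewrite triangle_braidV !mulgA mulgK mulgKV.
Qed.

(** With [w = u ^ r^-1], both forms of the sum give [t * u = t * (w * t) = (t * w) * t = u * t]. *)
Lemma translation_commute : commute t u.
Proof.
by rewrite /commute -{1}translation_sum_sym mulgA translation_sum.
Qed.

Lemma translation_turn : u ^ r^-1 = t^-1 * u.
Proof. by rewrite -{2}translation_sum mulKg. Qed.

Lemma translation_half_turn : t ^ (r ^+ 3) = t^-1.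
Proof.
have r3 : r ^+ 3 * r ^+ 3 = 1 by rewrite -expgD r6.
by rewrite conjgE /t -(mulgA f) r3 mulg1 (invMg f) fV.
Qed.

Lemma translation_turn_half_turn : u ^ (r ^+ 3) = u^-1.
Proof.
rewrite -conjgM (_ : r^-1 * r ^+ 3 = r ^+ 3 * r^-1); last first.
  by apply: commute_sym; apply: commuteV; apply/commute_sym/commuteX.
by rewrite (conjgM _ (r ^+ 3)) translation_half_turn conjVg.
Qed.

End TriangleGroup.

(** * Subgroups of the integers and Hermite normal forms of plane lattices *)

Section IntegerLattices.

Local Open Scope ring_scope.

Lemma int_subgroup_cyclic (H : int -> Prop) (a : nat) :
    (forall x y, H x -> H y -> H (x - y)) -> (0 < a)%N -> H a%:Z ->
  exists2 m : nat, (0 < m)%N & forall x, H x <-> exists l, x = l * m%:Z.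
Proof.
move=> HB a_gt0 Ha.
(* Excluded middle makes membership boolean, so that a least positive element exists; division by it
   leaves a smaller remainder in [H], which must be 0. *)
pose P n : bool :=
  (0 < n)%N && (if excluded_middle_informative (H n%:Z) then true else false).
have PP n : P n <-> (0 < n)%N /\ H n%:Z.
  rewrite /P; case: excluded_middle_informative => Hn; rewrite ?andbT ?andbF.
    by split=> [->|[]].
  by split=> // [[]].
have exP : exists n, P n by exists a; apply/PP.
have H0 : H 0 by rewrite -(subrr a%:Z); apply: HB.
have HN x : H x -> H (- x) by rewrite -sub0r => Hx; apply: HB.
have HD x y : H x -> H y -> H (x + y).
  by move=> Hx Hy; rewrite -(opprK y); apply: HB => //; apply: HN.
case: (ex_minnP exP) => m /PP[m_gt0 Hm] m_min; exists m => // x.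
have HM l : H (l * m%:Z).
  have Hn (n : nat) : H (n%:Z * m%:Z).
    elim: n => [|n IHn]; first by rewrite mul0r.
    by rewrite intS mulrDl mul1r; apply: HD.
  case: l => n //; rewrite NegzE mulNr; exact/HN/Hn.
split=> [Hx | [l ->]//]; exists (x %/ m%:Z)%Z.
have xE := divz_eq x m%:Z.
have: (0 <= x %% m%:Z)%Z by apply: modz_ge0; lia.
have: ((x %% m%:Z)%Z < m%:Z) by apply: ltz_pmod; lia.
have: H (x %% m%:Z)%Z.
  by have := HB _ _ Hx (HM (x %/ m%:Z)%Z); rewrite {1}xE addrC addKr.
case rE: (x %% m%:Z)%Z => [r|r] // Hr lt_rm _; rewrite {1}xE rE.
suff: r = 0%N by move->; rewrite addr0.
apply/eqP; rewrite eqn0Ngt; apply/negP => r_gt0.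
by have := m_min r (proj2 (PP r) (conj r_gt0 Hr)); lia.
Qed.

(* (m, 0), (s, k) is the Hermite normal form basis of L; for the lattice of the
   vertices of degree 3 it is (M(q), 0), (S^+(q), K(q)). *)
Definition has_basis (L : int -> int -> Prop) (m k s : nat) :=
  [/\ (0 < m)%N, (0 < k)%N, (s < m)%N
    & forall x y, L x y <->
        exists i j, x = i * s%:Z + j * m%:Z /\ y = i * k%:Z].

(** Here [m] generates the points of [L] on the horizontal axis, [k] generates the ordinates of [L],
    and [s] is the abscissa of a point at height [k], reduced modulo [m]. *)
Lemma lattice_basis_exists (L : int -> int -> Prop) (a b : nat) :
    (forall x y x' y', L x y -> L x' y' -> L (x - x') (y - y')) ->
    (0 < a)%N -> L a%:Z 0 -> (0 < b)%N -> L 0 b%:Z ->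
  exists m k s, has_basis L m k s.
Proof.
move=> LB a_gt0 La b_gt0 Lb.
have [|m m_gt0 Lm] := @int_subgroup_cyclic (L^~ 0) a _ a_gt0 La.
  by move=> x y Lx Ly; have := LB _ _ _ _ Lx Ly; rewrite subr0.
have [||k k_gt0 Lk] :=
    @int_subgroup_cyclic (fun y => exists x, L x y) b _ b_gt0.
- by move=> y y' [x Lx] [x' Lx']; exists (x - x'); apply: LB.
- by exists 0.
have [s0 Ls0] : exists x, L x k%:Z by apply/Lk; exists 1; rewrite mul1r.
have L0 : L 0 0 by rewrite -{1}(subrr a%:Z) -{1}(subr0 0); apply: LB.
have LN x y : L x y -> L (- x) (- y).
  by rewrite -(sub0r x) -(sub0r y) => Lxy; apply: LB.
have LD x y x' y' : L x y -> L x' y' -> L (x + x') (y + y').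
  by move=> Hx Hy; rewrite -(opprK x') -(opprK y'); apply: LB => //; apply: LN.
have Lmj j : L (j * m%:Z) 0 by apply/Lm; exists j.
have [s sE] : exists s : nat, s%:Z = (s0 %% m%:Z)%Z.
  by exists `|(s0 %% m%:Z)%Z|%N; rewrite gez0_abs // modz_ge0 //; lia.
have Ls : L s%:Z k%:Z.
  have -> : s%:Z = s0 - (s0 %/ m%:Z)%Z * m%:Z.
    by rewrite sE {2}(divz_eq s0 m%:Z) addrC addKr.
  by rewrite -(subr0 k%:Z); apply: LB.
have Lsi i : L (i * s%:Z) (i * k%:Z).
  have Ln (n : nat) : L (n%:Z * s%:Z) (n%:Z * k%:Z).
    elim: n => [|n IHn]; first by rewrite !mul0r.
    by rewrite intS !mulrDl !mul1r; apply: LD.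
  case: i => n //; rewrite NegzE !mulNr; exact/LN/Ln.
exists m, k, s; split=> //.
  have: ((s0 %% m%:Z)%Z < m%:Z) by apply: ltz_pmod; lia.
  by rewrite -sE.
move=> x y; split=> [Lxy | [i [j [-> ->]]]]; last first.
  by rewrite -(addr0 (i * k%:Z)); apply: LD.
have [i yE] : exists i, y = i * k%:Z by apply/Lk; exists x.
have [|j xE] := (Lm (x - i * s%:Z)).1.
  by rewrite -(subrr (i * k%:Z)) -{1}yE; apply: LB.
by exists i, j; split=> //; rewrite -xE addrC subrK.
Qed.

(* (x, y) |-> (- y, x + y) is the rotation by a sixth of a turn, written in the
   basis formed by the unit vectors of two successive classes. *)
Lemma rotated_basis (L : int -> int -> Prop) (m k s m' k' s' : nat) :
    has_basis L m k s -> has_basis (fun x y => L (- y) (x + y)) m' k' s' ->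
  k' = gcdn s m /\ m' = (k * (m %/ gcdn s m))%N.
Proof.
move=> [m_gt0 k_gt0 _ LE] [m'_gt0 k'_gt0 _ L'E].
pose g := gcdn s m.
have g_gt0 : (0 < g)%N by rewrite gcdn_gt0 m_gt0 orbT.
have [m1 mE] : exists m1, m = (m1 * g)%N by apply/dvdnP/dvdn_gcdr.
have [s1 s_E] : exists s1, s = (s1 * g)%N by apply/dvdnP/dvdn_gcdl.
have gE : gcdn s m = g by [].
have mgE : (m %/ g = m1)%N by rewrite mE mulnK.
have cop : coprime s1 m1.
  by move: gE; rewrite mE s_E -muln_gcdl /coprime -{2}(mul1n g) => /eqP;
     rewrite eqn_pmul2r.
rewrite gE mgE.
have [[u v] /= bez] : exists uv, uv.1 * s1%:Z + uv.2 * m1%:Z = 1 :> int.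
  exact/coprimezP.
have eq_dvd (a b : nat) (i j : int) :
    a%:Z = i * b%:Z -> b%:Z = j * a%:Z -> a = b.
  move=> Ea Eb; apply/eqP; rewrite eqn_dvd.
  by apply/andP; split; apply/(@dvdzP a b) || apply/(@dvdzP b a);
    [exists j | exists i].
split.
  (* The ordinates of the rotated lattice are the opposites of the abscissas of [L], which are the
     combinations of [s] and [m]; so [k'] and [g] divide each other. *)
  have /(L'E _ _).2 /LE[i [j [E _]]] : exists i j,
      s'%:Z = i * s'%:Z + j * m'%:Z /\ k'%:Z = i * k'%:Z.
    by exists 1, 0; rewrite !mul1r mul0r addr0.
  have /(L'E (- u * k%:Z - g%:Z) g%:Z).1[i' [_ [_ E']]] :
      L (- g%:Z) (- u * k%:Z - g%:Z + g%:Z).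
    apply/LE; exists (- u), (- v); split; last by rewrite subrK.
    by rewrite mE s_E !PoszM !mulrA -mulrDl !mulNr -opprD bez mulN1r.
  apply: (eq_dvd _ _ (- (i * s1%:Z + j * m1%:Z)) i') => //.
  by rewrite -(opprK k'%:Z) E mE s_E !PoszM; ring.
(* The points [(x, 0)] of the rotated lattice are the points [(0, x)] of [L]. Since
   [i * s + j * m = 0] forces [m1] to divide [i], they are the multiples of [k * m1]. *)
have /(L'E _ _).2 /LE[i [j [E E']]] : exists i j,
    m'%:Z = i * s'%:Z + j * m'%:Z /\ 0 = i * k'%:Z.
  by exists 0, 1; rewrite !mul1r !mul0r add0r.
have /(L'E (k * m1)%N%:Z 0).1[i' [j' [F /esym/eqP]]] :
    L (- 0) ((k * m1)%N%:Z + 0).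
  apply/LE; exists m1%:Z, (- s1%:Z); rewrite mE s_E !PoszM; split; ring.
rewrite mulf_eq0 => /orP[/eqP i'0 | ]; last by move: k'_gt0; case: (k').
have [l iE] : exists l, i = l * m1%:Z.
  apply/dvdzP; rewrite -(@Gauss_dvdzr _ s1%:Z) 1?coprimez_sym //.
  apply/dvdzP; exists (- j); apply: (@mulIf _ g%:Z); first by
    move: g_gt0; case: (g).
  apply/eqP; rewrite -subr_eq0 -oppr0 E mE s_E !PoszM; apply/eqP; ring.
apply: (eq_dvd _ _ l j') => //.
  by rewrite -(addr0 m'%:Z) E' iE PoszM; ring.
by rewrite F i'0 mul0r add0r.
Qed.

End IntegerLattices.

(** * Explicit billiard sequences *)

Section Billiards.

Local Open Scope ring_scope.

(* The theta-billiard sequence with theta = s / m has F(2i + 1) = - i theta and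
   F(2i) = i theta modulo 1; this is m F(j). *)
Definition billiard_num (m s j : nat) : int :=
  if odd j then (- (j./2 * s)%N%:Z %% m%:Z)%Z else ((j./2 * s)%N%:Z %% m%:Z)%Z.

(** The sum of the two residues is congruent to [s] modulo [m] and lies between 0 and
    [2 * m - 2]. *)
Lemma modz_sum_cases (x y : int) (m s : nat) :
    (s < m)%N -> x + y = s%:Z ->
  (x %% m%:Z)%Z + (y %% m%:Z)%Z = s%:Z \/
  (x %% m%:Z)%Z + (y %% m%:Z)%Z = m%:Z + s%:Z.
Proof.
move=> lt_sm xy; have m_gt0 : 0 < m%:Z by lia.
have x_ge0 : 0 <= (x %% m%:Z)%Z by apply: modz_ge0; lia.
have y_ge0 : 0 <= (y %% m%:Z)%Z by apply: modz_ge0; lia.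
have x_lt : (x %% m%:Z)%Z < m%:Z by apply: ltz_pmod.
have y_lt : (y %% m%:Z)%Z < m%:Z by apply: ltz_pmod.
have E : (x %% m%:Z)%Z + (y %% m%:Z)%Z =
    s%:Z - ((x %/ m%:Z)%Z + (y %/ m%:Z)%Z) * m%:Z.
  by rewrite -xy {2}(divz_eq x m%:Z) {2}(divz_eq y m%:Z); ring.
move: (_ + (y %/ _)%Z) E => l E.
have l_lt : l < 1 by rewrite -(ltr_pM2r m_gt0); lia.
have l_gt : -2 < l by rewrite -(ltr_pM2r m_gt0); lia.
have [l0 | l1] : l = 0 \/ l = -1 by lia.
  by left; subst l; lia.
by right; subst l; lia.
Qed.

Lemma billiard_num_sequence (R : realFieldType) (m s : nat) :
    (0 < s < m)%N ->
  billiard_sequence (s%:R / m%:R : R)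
    (fun j => (billiard_num m s j)%:~R / m%:R).
Proof.
case/andP=> s_gt0 lt_sm; have m_gt0 : (0 < m)%N by lia.
have mR_gt0 : 0 < m%:R :> R by rewrite ltr0n.
have mR_neq0 : m%:R != 0 :> R by rewrite gt_eqF.
have mz_gt0 : 0 < m%:Z by lia.
have sumE i j (c : int) : billiard_num m s i + billiard_num m s j = c ->
    (billiard_num m s i)%:~R / m%:R + (billiard_num m s j)%:~R / m%:R =
    c%:~R / m%:R :> R.
  by move=> <-; rewrite intrD mulrDl.
split.
- by rewrite divr_gt0 ?ltr0n //= ltr_pdivrMr // mul1r ltr_nat.
- move=> j _; rewrite divr_ge0 ?ler0n ?ler0z //=.
    rewrite ltr_pdivrMr // mul1r -[m%:R]/(m%:Z%:~R) ltr_int.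
    by rewrite /billiard_num; case: ifP => _; apply: ltz_pmod.
  by rewrite /billiard_num; case: ifP => _; apply: modz_ge0; lia.
- by rewrite /billiard_num /= mul0n oppr0 mod0z mul0r.
- move=> j odd_j; have jE := odd_double_half j.
  have [|E|E] := @modz_sum_cases (- (j./2 * s)%N%:Z)
                    ((j.+1)./2 * s)%N%:Z m s lt_sm.
  + by rewrite /= uphalf_half odd_j; lia.
  + by left; rewrite (sumE _ _ s%:Z) // /billiard_num /= odd_j.
  + right; rewrite (sumE _ _ (m%:Z + s%:Z)) ?intrD ?mulrDl ?divff //.
    by rewrite /billiard_num /= odd_j.
- move=> j _ even_j; have jE := odd_double_half j.
  have [|E|E] := @modz_sum_cases (j./2 * s)%N%:Z
                    (- ((j.+1)./2 * s)%N%:Z) m 0 m_gt0.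
  + by rewrite /= uphalf_half (negbTE even_j); lia.
  + left; rewrite (sumE _ _ 0) ?mul0r //.
    by rewrite /billiard_num /= (negbTE even_j).
  + right; rewrite (sumE _ _ m%:Z) ?divff //.
    by rewrite /billiard_num /= (negbTE even_j) /= E addr0.
Qed.

End Billiards.

Lemma mkseqD T (f : nat -> T) n1 n2 :
  mkseq f (n1 + n2) = mkseq f n1 ++ mkseq (fun i => f (n1 + i)%N) n2.
Proof.
by rewrite /mkseq iotaD add0n -[X in iota X n2]addn0 iotaDl map_cat -map_comp.
Qed.

(** * The action of the lattice group on darts *)

Section Translations.

Variable G : rotation_graph.
Implicit Types (d e : dart G) (x y : int).

(* forward maps a dart to the next dart of its class, straight ahead; at a
   vertex of degree 3 this is the dart pointing backwards along the same edge.
   sideways translates a dart by one step in the direction of the next class. *)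
Definition half_turn : {perm dart G} := (turn ^+ 3)%g.
Definition forward : {perm dart G} := (flip * half_turn)%g.
Definition sideways : {perm dart G} := (forward ^ turn^-1)%g.

Definition shift x y d : dart G :=
  (zexpg forward x * zexpg sideways y)%g d.

Hypothesis P_triangulation : triangulation G.
Hypothesis P_degree : forall v : vertex G, degree v = 3 \/ degree v = 6.

Lemma degree_porbit d : degree (src d) = #|porbit turn d|.
Proof. by apply: eq_card => e; rewrite !inE eq_sym same_src. Qed.

Lemma turn6 : (turn ^+ 6 = 1 :> {perm dart G})%g.
Proof.
apply/permP => d; rewrite perm1 permX.
have := iter_porbit turn d; rewrite -degree_porbit.
case: (P_degree (src d)) => -> // E3.
by rewrite -[in RHS]E3 -[in RHS]E3.
Qed.

Lemma flip2 : (flip * flip = 1 :> {perm dart G})%g.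
Proof. by apply/permP => d; rewrite permM perm1 flipK. Qed.

Lemma face3 : ((flip * turn^-1) ^+ 3 = 1 :> {perm dart G})%g.
Proof.
apply/permP => d; rewrite perm1 permX.
by have := iter_porbit (face G) d; rewrite (P_triangulation d).1.
Qed.

Lemma half_turnK : involutive half_turn.
Proof. by move=> d; rewrite -permM -expgD turn6 perm1. Qed.

Lemma forward_sideways : commute forward sideways.
Proof. exact: translation_commute turn6 flip2 face3. Qed.

Lemma shiftD x y x' y' d :
  shift x' y' (shift x y d) = shift (x + x') (y + y') d.
Proof.
rewrite /shift -permM !zexpgD !mulgA; congr (fun_of_perm (_ * _)%g d).
rewrite -!mulgA; congr (_ * _)%g.
exact/commute_sym/zexpg_commute/forward_sideways.
Qed.

Lemma shift0 d : shift 0 0 d = d.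
Proof. by rewrite /shift mulg1 perm1. Qed.

Lemma shift_inj x y : injective (shift x y).
Proof. exact: perm_inj. Qed.

Lemma half_turn_shift x y d :
  half_turn (shift x y d) = shift (- x) (- y) (half_turn d).
Proof.
rewrite /shift -!permM conjgC conjMg !zexpgJ.
rewrite (translation_half_turn turn6 flip2).
by rewrite (translation_turn_half_turn turn6 flip2) !zexpgV.
Qed.

(** The change of frame comes from [translation_turn]: conjugating [sideways] by [turn^-1] gives
    [forward^-1 * sideways]. *)
Lemma shift_turn x y d : shift x y (turn d) = turn (shift (- y) (x + y) d).
Proof.
have tu := forward_sideways.
rewrite /shift -!permM conjgCV conjMg !zexpgJ -/sideways.
have Vtu : commute forward^-1%g sideways.
  by apply: commute_sym; apply: commuteV; apply: commute_sym.
rewrite (translation_turn turn6 flip2 face3) (zexpgM y Vtu).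
rewrite zexpgV !mulgA (zexpg_commute _ _ (commute_sym tu)).
by rewrite -(mulgA _ (zexpg _ x)) -zexpgD.
Qed.

Lemma forwardE d : forward d = shift 1 0 d.
Proof. by rewrite /shift /= expg1 mulg1. Qed.

Lemma sidewaysE d : sideways d = shift 0 1 d.
Proof. by rewrite /shift /= expg1 mul1g. Qed.

Lemma forward_turn d : forward (turn d) = turn (sideways d).
Proof. by rewrite forwardE shift_turn oppr0 addr0 -sidewaysE. Qed.

Lemma flipE d : flip d = half_turn (forward d).
Proof. by rewrite /forward (permM flip) half_turnK. Qed.

Lemma src_turnX n d : src ((turn ^+ n)%g d) = src d.
Proof. by apply/esym/eqP; rewrite same_src mem_porbit. Qed.

Lemma src_turn d : src (turn d) = src d.
Proof. exact: (src_turnX 1). Qed.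

Lemma src_half_turn d : src (half_turn d) = src d.
Proof. exact: src_turnX. Qed.

Lemma tgtE d : tgt d = src (forward d).
Proof. by rewrite /tgt flipE src_half_turn. Qed.

Lemma degree3P d : reflect (half_turn d = d) (degree (src d) == 3).
Proof.
apply: (iffP eqP) => [d3 | dK].
  by have := iter_porbit turn d; rewrite -degree_porbit d3 permX.
case: (P_degree (src d)) => // d6.
have := uniq_traject_porbit turn d; rewrite -degree_porbit d6 /=.
move: dK; rewrite /half_turn permX /= => ->.
by rewrite !inE eqxx !orbT.
Qed.

Local Open Scope ring_scope.

Lemma half_turn_turn d : half_turn (turn d) = turn (half_turn d).
Proof. by rewrite -!permM -expgS -expgSr. Qed.

Lemma tgt_bounded_shift d e :
  src d = src e ->
  exists x y, tgt d = src (shift x y e) /\ `|y| <= 1.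
Proof.
move/esym/eqP; rewrite same_src => /porbitP[n ->]; rewrite tgtE.
(* The three bounds together describe a hexagon stable under the rotation [(x, y) |-> (- y, x + y)],
   which makes the induction on the number of turns work. *)
suff [x [y [E y1 xy1 _]]] : exists x y,
    [/\ forward ((turn ^+ n)%g e) = (turn ^+ n)%g (shift x y e),
        `|y| <= 1, `|x + y| <= 1 & `|x| <= 1].
  by exists x, y; rewrite E src_turnX.
elim: n e => [|n IHn] e.
  by exists 1, 0; rewrite !perm1 forwardE; split.
have [x [y [E y1 xy1 x1]]] := IHn (turn e).
exists (- y), (x + y); rewrite expgS !(permM turn) E shift_turn.
by split; rewrite ?normrN // addrC addrK.
Qed.

Variable cls : dart G -> 'Z_3.
Hypothesis cls_flip : forall d, cls (flip d) = cls d.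
Hypothesis cls_turn : forall d, cls (turn d) = cls d + 1.

Lemma cls_turnX n d : cls ((turn ^+ n)%g d) = cls d + n%:R.
Proof.
elim: n => [|n IHn]; first by rewrite perm1 addr0.
by rewrite expgSr (permM _ turn) cls_turn IHn -addrA -natr1.
Qed.

Lemma cls_half_turn d : cls (half_turn d) = cls d.
Proof. by rewrite cls_turnX (_ : 3%:R = 0) ?addr0 //; apply/eqP. Qed.

Lemma cls_shift x y d : cls (shift x y d) = cls d.
Proof.
have clsF e : cls (forward e) = cls e.
  by rewrite /forward (permM flip) cls_half_turn cls_flip.
have clsS e : cls (sideways e) = cls e.
  by apply: (addIr 1); rewrite -!cls_turn -forward_turn.
have clsX (g : {perm dart G}) z e :
    (forall e, cls (g e) = cls e) -> cls (zexpg g z e) = cls e.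
  move=> clsg; have clsgX n e' : cls ((g ^+ n)%g e') = cls e'.
    by elim: n e' => [|n IHn] e'; rewrite ?perm1 // expgS permM IHn.
  by case: z => n //=; rewrite -(clsgX n.+1 ((g ^- n.+1)%g e)) permKV.
by rewrite /shift permM !clsX.
Qed.

(** Each turn adds 1 to the class in ['Z_3], so the number of turns from [d] to [e] is a multiple of
    3. *)
Lemma same_class_at_vertex d e :
  src d = src e -> cls d = cls e -> e = d \/ e = half_turn d.
Proof.
move/eqP; rewrite same_src => /porbitP[n ->]; rewrite cls_turnX => /eqP.
rewrite eq_sym -subr_eq0 addrC addKr => n0.
have /dvdnP[k ->] : (3 %| n)%N.
  by rewrite /dvdn -(val_Zp_nat (isT : 1 < 3)%N) (eqP n0).
elim: k => [|k]; first by left; rewrite perm1.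
rewrite mulSn addnC expgD (permM (turn ^+ (k * 3))%g) => -[-> | ->].
  by right.
by left; apply: half_turnK.
Qed.

Lemma src_eqP d e :
  cls d = cls e -> (src d = src e <-> d = e \/ d = half_turn e).
Proof.
move=> de; split=> [/esym/same_class_at_vertex | [] ->]; first by apply.
  by [].
exact: src_half_turn.
Qed.

(** * Coordinates centred at a vertex of degree 3 *)

Section BaseDart.

Variable a : dart G.
Hypothesis half_turn_a : half_turn a = a.

Lemma half_turn_shift_base x y : half_turn (shift x y a) = shift (- x) (- y) a.
Proof. by rewrite half_turn_shift half_turn_a. Qed.

Lemma shift_eqP x y x' y' :
  shift x y a = shift x' y' a <-> shift (x - x') (y - y') a = a.
Proof.
split=> [E | E].
  by apply: (@shift_inj x' y'); rewrite shiftD !subrK E.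
by rewrite -{2}E shiftD !subrK.
Qed.

Lemma src_shift_eqP x y x' y' :
  src (shift x y a) = src (shift x' y' a) <->
  shift (x - x') (y - y') a = a \/ shift (x + x') (y + y') a = a.
Proof.
rewrite src_eqP ?cls_shift // half_turn_shift_base.
by rewrite !shift_eqP !opprK.
Qed.

(* Such an equality would make shift i j a its own reversal. *)
Lemma shift_odd_neq i j : shift (i * 2 + 1) (j * 2) a <> a.
Proof.
move=> E; have /eqP[] := flip_neq (shift i j a).
rewrite flipE forwardE shiftD half_turn_shift_base addr0.
apply/esym/shift_eqP; rewrite !opprK -{2}E; congr shift; ring.
Qed.

End BaseDart.

(* When half_turn a = a, these are the (x, y) such that shift x y a leaves a
   vertex of degree 3; the stabiliser of a in the translation group is then
   twice this lattice. *)
Definition vertex_lattice a x y : Prop := shift (x * 2) (y * 2) a = a.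

Hypothesis P_connected : connected G.

Section VertexLattice.

Variable a : dart G.
Hypothesis half_turn_a : half_turn a = a.

Lemma half_turn_turn_base : half_turn (turn a) = turn a.
Proof. by rewrite half_turn_turn half_turn_a. Qed.

Lemma vertex_lattice_turn x y :
  vertex_lattice (turn a) x y <-> vertex_lattice a (- y) (x + y).
Proof.
rewrite /vertex_lattice shift_turn mulrDl mulNr; split=> [|->] //.
exact: perm_inj.
Qed.

Lemma vertex_lattice_shift x y x' y' :
  vertex_lattice (shift x y a) x' y' <-> vertex_lattice a x' y'.
Proof.
rewrite /vertex_lattice shiftD addrC (addrC y) -shiftD; split=> [|->] //.
exact: shift_inj.
Qed.

Lemma half_turn_shift_fixed x y :
  half_turn (shift x y a) = shift x y a <-> vertex_lattice a x y.
Proof.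
rewrite half_turn_shift_base //; split=> [/esym|] E.
  move/shift_eqP: E; rewrite !opprK /vertex_lattice; congr (_ = _).
  by congr shift; ring.
apply/esym/shift_eqP; rewrite -[RHS]E; congr shift; ring.
Qed.

(** The parities (odd, even), (even, odd) and (odd, odd) become (odd, even) in the frames of [a],
    [turn a] and [turn (turn a)] respectively, where [shift_odd_neq] excludes them. *)
Lemma shift_fixed_even x y :
  shift x y a = a -> exists i j,
    [/\ x = i * 2, y = j * 2 & vertex_lattice a i j].
Proof.
have odd z : exists i, z = i * 2 \/ z = i * 2 + 1 :> int.
  by exists (z %/ 2)%Z; lia.
have ht1 := half_turn_turn_base.
have ht2 : half_turn (turn (turn a)) = turn (turn a).
  by rewrite !half_turn_turn half_turn_a.
have [i [-> | ->]] := odd x; have [j [-> | ->]] := odd y => E.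
- by exists i, j.
- case: (@shift_odd_neq _ ht1 (i + j) (- i)); rewrite shift_turn -[in RHS]E.
  by congr (turn (shift _ _ _)); ring.
- by have := shift_odd_neq half_turn_a E.
- case: (@shift_odd_neq _ ht2 j (- i - j - 1)); rewrite !shift_turn -[in RHS]E.
  by congr (turn (turn (shift _ _ _))); ring.
Qed.

(** The orders of [forward] and [sideways] give nonzero lattice points on both axes. *)
Lemma vertex_lattice_basis :
  exists m k s, has_basis (vertex_lattice a) m k s.
Proof.
apply: (@lattice_basis_exists _ #[forward]%g #[sideways]%g) => //.
- move=> x y x' y'; rewrite /vertex_lattice !mulrBl => E E'.
  by apply/shift_eqP; rewrite E E'.
- by rewrite /vertex_lattice mul0r /shift -PoszM /= expgM expg_order expg1n
             mulg1 perm1.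
- by rewrite /vertex_lattice mul0r /shift -PoszM /= expgM expg_order expg1n
             mulg1 perm1.
Qed.

Lemma vertex_shift_exists v : exists x y, v = src (shift x y a).
Proof.
have reach p v0 x y : v0 = src (shift x y a) -> path (@adj G) v0 p ->
    exists x' y', last v0 p = src (shift x' y' a).
  elim: p v0 x y => [|w p IHp] v0 x y v0E /=; first by exists x, y.
  case/andP=> /existsP[d /andP[/eqP src_d /eqP <-]].
  have [|x' [y' [E _]]] := @tgt_bounded_shift d (shift x y a).
    by rewrite src_d.
  by rewrite shiftD in E; apply: IHp E.
have /connectP[p ap ->] := P_connected (src a) v.
by apply: reach ap; rewrite -[in LHS](shift0 a).
Qed.

End VertexLattice.

(** * Straight paths and maximal paths of a class *)

Definition straight d n : seq (dart G) := mkseq (fun j => shift j%:Z 0 d) n.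

Lemma straightS d n : straight d n.+1 = d :: straight (forward d) n.
Proof.
rewrite /straight /mkseq /= shift0; congr (_ :: _).
rewrite -(addn0 1%N) iotaDl -map_comp; apply: eq_map => j /=.
by rewrite forwardE shiftD -intS.
Qed.

Lemma straight_vertices d n :
  path_vertices (src d) (straight d n) =
  mkseq (fun j => src (shift j%:Z 0 d)) n.+1.
Proof.
rewrite /path_vertices /straight /mkseq /= shift0 (iotaDl 1 0) -!map_comp.
congr (_ :: _); apply: eq_map => j /=.
by rewrite tgtE forwardE shiftD addrC -intS.
Qed.

Lemma walk_straight d n : walk (src d) (straight d n).
Proof. by elim: n d => // n IHn d; rewrite straightS /= eqxx tgtE IHn. Qed.

(** At each vertex the class offers only the dart straight ahead and the one going back; the latter
    would revisit a vertex. *)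
Lemma class_walk_straight d p :
    walk (tgt d) p -> uniq (src d :: path_vertices (tgt d) p) ->
    all (fun e => cls e == cls d) p ->
  p = straight (forward d) (size p).
Proof.
elim: p d => [|e p IHp] d //=; rewrite straightS tgtE.
case/andP=> /eqP src_e wp /andP[ed uniq_p] /andP[/eqP cls_e all_p].
have cls_f : cls (forward d) = cls e by rewrite forwardE cls_shift.
have [eE | eE] := same_class_at_vertex (esym src_e) cls_f; last first.
  case/negP: ed; rewrite eE -flipE /path_vertices /=.
  by rewrite /tgt flipK !inE eqxx orbT.
rewrite -eE; congr (_ :: _).
by apply: IHp; rewrite ?src_e //= cls_e.
Qed.

Section MaximalPaths.

Variables (a : dart G) (m k s : nat).
Hypothesis half_turn_a : half_turn a = a.
Hypothesis basis_a : has_basis (vertex_lattice a) m k s.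

Lemma shift_fixedP x y :
  shift x y a = a <->
  exists i j, x = (i * s%:Z + j * m%:Z) * 2 /\ y = (i * k%:Z) * 2.
Proof.
have [_ _ _ basisE] := basis_a.
split.
  move=> /(shift_fixed_even half_turn_a)[i [j [-> -> /basisE[c [l [-> ->]]]]]].
  by exists c, l.
by case=> i [j [-> ->]]; apply/basisE; exists i, j.
Qed.

Lemma forward_fixedP x : shift x 0 a = a <-> exists l, x = l * (2 * m)%N%:Z.
Proof.
have [_ k_gt0 _ _] := basis_a.
rewrite shift_fixedP; split=> [[i [j [-> E]]] | [l ->]].
  have -> : i = 0 by move: E; case: (k) k_gt0 => //; nia.
  by exists j; rewrite PoszM; ring.
by exists 0, l; split; rewrite ?PoszM; ring.
Qed.

Lemma forward_shift_mod x :
  exists z : nat, [/\ (z < 2 * m)%N, z%:Z = (x %% (2 * m)%N%:Z)%Z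
                    & shift x 0 a = shift z%:Z 0 a].
Proof.
have [m_gt0 _ _ _] := basis_a.
have m2_gt0 : (0 < (2 * m)%N%:Z)%R by lia.
have zE : `|(x %% (2 * m)%N%:Z)%Z|%N%:Z = (x %% (2 * m)%N%:Z)%Z.
  by rewrite gez0_abs // modz_ge0 //; lia.
exists `|(x %% (2 * m)%N%:Z)%Z|%N; split=> //.
  by rewrite -ltz_nat zE ltz_pmod.
apply/shift_eqP => //; rewrite subrr; apply/forward_fixedP.
exists (x %/ (2 * m)%N%:Z)%Z; rewrite zE.
by rewrite {1}(divz_eq x (2 * m)%N%:Z) addrK.
Qed.

Lemma src_forward_eqP x y :
  src (shift x 0 a) = src (shift y 0 a) <->
  (exists l, x - y = l * (2 * m)%N%:Z) \/ (exists l, x + y = l * (2 * m)%N%:Z).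
Proof. by rewrite src_shift_eqP // subrr ?addr0 !forward_fixedP. Qed.

(** Vertices of the line are integers modulo [2 * m] up to sign, represented by 0 to [m]; the vertex
    at [m + 1] repeats the one at [m - 1]. *)
Lemma straight_uniq n :
  uniq (path_vertices (src a) (straight a n)) = (n <= m)%N.
Proof.
have [m_gt0 _ _ _] := basis_a.
rewrite straight_vertices; apply/mkseq_uniqP/idP => [inj | le_nm i j].
  rewrite leqNgt; apply/negP => lt_mn.
  have: m.+1 = m.-1.
    apply: inj; rewrite ?inE ?ltnS //; first by lia.
    by apply/src_forward_eqP; right; exists 1; lia.
  by lia.
have m2_gt0 : (0 < (2 * m)%N%:Z)%R by lia.
rewrite !inE => lt_i lt_j /src_forward_eqP[[l E] | [l E]].
  have l_lt1 : l < 1 by rewrite -(ltr_pM2r m2_gt0) -E; lia.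
  have l_gt : -1 < l by rewrite -(ltr_pM2r m2_gt0) -E; lia.
  have l0 : l = 0 by lia.
  by subst l; lia.
have l_lt2 : l < 2 by rewrite -(ltr_pM2r m2_gt0) -E; lia.
have l_gt : -1 < l by rewrite -(ltr_pM2r m2_gt0) -E; lia.
have [l0 | l1] : l = 0 \/ l = 1 by lia.
  by subst l; lia.
by subst l; lia.
Qed.


(** The line has period [2 * m] and turns back at the far end: positions 0 to [m - 1] are the darts
    of the path, [m] to [2 * m - 1] their reversals. *)
Lemma straight_edgesP d :
  reflect (exists x, d = shift x 0 a) (d \in path_edges (straight a m)).
Proof.
rewrite inE; apply: (iffP orP) => [[] /mapP[j _ dE] | [x ->]].
- by exists j.
- exists (- (j%:Z + 1)); rewrite -[LHS]flipK dE flipE forwardE shiftD addr0.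
  by rewrite half_turn_shift_base // oppr0.
have [z [lt_z _ ->]] := forward_shift_mod x.
case: (ltnP z m) => [lt_zm | le_mz].
  by left; apply/mapP; exists z; rewrite ?mem_iota.
right; apply/mapP; exists (2 * m - z.+1)%N; first by rewrite mem_iota; lia.
rewrite flipE forwardE shiftD half_turn_shift_base // addr0 oppr0.
apply/shift_eqP => //; rewrite subrr; apply/forward_fixedP; exists (- 1); lia.
Qed.

Lemma straight_verticesP v :
  reflect (exists x, v = src (shift x 0 a))
          (v \in path_vertices (src a) (straight a m)).
Proof.
rewrite straight_vertices; apply: (iffP mapP) => [[j _ ->] | [x ->]].
  by exists j.
have [z [lt_z _ ->]] := forward_shift_mod x.
case: (ltnP z m) => [lt_zm | le_mz].
  by exists z; rewrite ?mem_iota //; lia.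
exists (2 * m - z)%N; first by rewrite mem_iota; lia.
by apply/src_forward_eqP; right; exists 1; lia.
Qed.

Lemma straight_class_path n :
  (n <= m)%N -> class_path cls (cls a) (src a) (straight a n).
Proof.
move=> le_nm; rewrite /class_path walk_straight straight_uniq le_nm /=.
by apply/allP => _ /mapP[j _ ->]; rewrite cls_shift.
Qed.

Lemma class_path_straight p :
    class_path cls (cls a) (src a) p ->
  p = straight a (size p) /\ (size p <= m)%N.
Proof.
move=> cp; suff pE : p = straight a (size p).
  by split=> //; move: cp => /and3P[_ + _]; rewrite -straight_uniq -pE.
case: p cp => // d p /and3P[/= /andP[/eqP src_d wp] uniq_p].
case/andP=> /eqP cls_d all_p.
have dE : d = a.
  by have [|] := same_class_at_vertex (esym src_d) (esym cls_d);
     rewrite ?half_turn_a.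
rewrite straightS -dE; congr (_ :: _); apply: class_walk_straight => //.
  by rewrite src_d.
by rewrite cls_d.
Qed.

(** This propagates membership along a walk of the class, so a walk that meets the path in one edge
    never leaves it; maximality follows. *)
Lemma straight_edges_step d e :
    cls d = cls a -> cls e = cls a -> src e = tgt d ->
  d \in path_edges (straight a m) = (e \in path_edges (straight a m)).
Proof.
move=> cls_d cls_e; rewrite tgtE src_eqP; last first.
  by rewrite forwardE cls_shift cls_d.
move=> eE; apply/straight_edgesP/straight_edgesP => [[x dE] | [x {}eE']].
  case: eE => ->; first by exists (x + 1); rewrite forwardE dE shiftD.
  exists (- (x + 1)).
  by rewrite forwardE dE shiftD half_turn_shift_base // addr0 oppr0.
case: eE; rewrite eE' forwardE => dE.
  exists (x - 1); apply: (@shift_inj 1 0).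
  by rewrite -dE shiftD subrK.
exists (- x - 1); apply: (@shift_inj 1 0); rewrite shiftD subrK.
by rewrite -[LHS]half_turnK -dE half_turn_shift_base // oppr0 addr0.
Qed.

Lemma walk_in_straight v p :
    walk v p -> all (fun d => cls d == cls a) p ->
    has (mem (path_edges (straight a m))) p ->
  all (mem (path_edges (straight a m))) p.
Proof.
elim: p v => //= d p IHp v /andP[_ wp] /andP[/eqP cls_d all_p].
case: p IHp wp all_p => [|e p] IHp; first by rewrite /= orbF andbT.
move=> wp all_p; have := wp => /= /andP[/eqP src_e _].
have := all_p => /= /andP[/eqP cls_e _].
have /= := IHp _ wp all_p.
rewrite (straight_edges_step cls_d cls_e src_e).
by case: (e \in _) => //= /(_ isT) ->.
Qed.

Lemma straight_maximal : maximal_path cls (cls a) (src a) (straight a m).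
Proof.
have [m_gt0 _ _ _] := basis_a.
split=> [|w p /and3P[wp _ all_p] sub_p]; first exact: straight_class_path.
apply/eqP; rewrite eqEsubset sub_p andbT.
have edges_flip d : (flip d \in path_edges (straight a m)) =
    (d \in path_edges (straight a m)).
  by rewrite !inE flipK orbC.
have: a \in path_edges p.
  by apply: (subsetP sub_p); apply/straight_edgesP; exists 0; rewrite shift0.
have a_in : a \in path_edges (straight a m).
  by apply/straight_edgesP; exists 0; rewrite shift0.
rewrite inE => ap; have /allP sub : all (mem (path_edges (straight a m))) p.
  apply: walk_in_straight wp all_p _; apply/hasP.
  case/orP: ap => ap; [exists a | exists (flip a)] => //=.
  by rewrite edges_flip.
apply/subsetP => d; rewrite inE => /orP[/sub //| /sub /=].
by rewrite edges_flip.
Qed.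

Lemma maximal_path_unique p :
  maximal_path cls (cls a) (src a) p -> p = straight a m.
Proof.
have [m_gt0 _ _ _] := basis_a.
case=> /class_path_straight[pE le_pm] max_p.
move: (size p) pE le_pm max_p => n -> le_nm max_n; congr straight.
apply/eqP; rewrite eqn_leq le_nm leqNgt; apply/negP => lt_nm.
have edges_nm : path_edges (straight a n) \subset path_edges (straight a m).
  have sub d : d \in straight a n -> d \in straight a m.
    case/mapP=> j; rewrite mem_iota => lt_jn ->; apply/mapP.
    by exists j; rewrite ?mem_iota //; lia.
  by apply/subsetP => d; rewrite !inE => /orP[] /sub ->; rewrite ?orbT.
(* The last dart of the path of length [m] separates it from any shorter one. *)
have /setP/(_ (shift m.-1%:Z 0 a)) :=
  max_n _ _ (straight_class_path (leqnn m)) edges_nm.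
have -> : shift m.-1%:Z 0 a \in path_edges (straight a m).
  by apply/straight_edgesP; exists m.-1.
have m2_gt0 : (0 < (2 * m)%N%:Z)%R by lia.
move/esym; rewrite inE => /orP[] /mapP[j]; rewrite mem_iota => lt_jn.
  move/shift_eqP; rewrite subrr => /forward_fixedP[l E].
  have l_lt1 : l < 1 by rewrite -(ltr_pM2r m2_gt0) -E; lia.
  have l_gt0 : 0 < l by rewrite -(ltr_pM2r m2_gt0) -E; lia.
  by lia.
rewrite flipE forwardE shiftD half_turn_shift_base // addr0 oppr0.
move/shift_eqP; rewrite subrr => /forward_fixedP[l E].
have l_lt0 : l < 0 by rewrite -(ltr_pM2r m2_gt0) -E; lia.
have l_gt : -1 < l by rewrite -(ltr_pM2r m2_gt0) -E; lia.
by lia.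
Qed.

Lemma max_pathE : max_path cls (cls a) (src a) = straight a m.
Proof.
apply: maximal_path_unique; apply: epsilon_spec.
by exists (straight a m); apply: straight_maximal.
Qed.

End MaximalPaths.

Lemma last_straight d n :
  last (src d) (map (@tgt G) (straight d n)) = src (shift n%:Z 0 d).
Proof.
elim: n d => [|n IHn] d; first by rewrite shift0.
by rewrite straightS /= tgtE IHn forwardE shiftD -intS.
Qed.

(* The second coordinate changes by at most 1 along an edge, which bounds the
   distance between two paths of class q from below. *)
Lemma walk_bounded_shift v p e :
    src e = v -> walk v p ->
  exists x y,
    last v (map (@tgt G) p) = src (shift x y e) /\ `|y| <= (size p)%:Z.
Proof.
elim: p v e => [|d p IHp] v e src_e /=.
  by exists 0, 0; rewrite shift0 normr0.
case/andP=> /eqP src_d wp.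
have [|x [y [E y1]]] := @tgt_bounded_shift d e; first by rewrite src_e.
have [x' [y' [E' y'1]]] := IHp _ _ (esym E) wp.
exists (x + x'), (y + y'); rewrite E' shiftD; split=> //.
by rewrite intS; apply: le_trans (ler_normD _ _) _; apply: lerD.
Qed.

(** * Path length and distance read off the lattice basis *)

Section Invariants.

Variables (a : dart G) (m k s : nat).
Hypothesis half_turn_a : half_turn a = a.
Hypothesis basis_a : has_basis (vertex_lattice a) m k s.

Lemma basis_shift x y : has_basis (vertex_lattice (shift x y a)) m k s.
Proof.
have [m_gt0 k_gt0 lt_sm basisE] := basis_a.
by split=> // x' y'; rewrite vertex_lattice_shift.
Qed.

Lemma degree3_shift v :
  degree v = 3%N -> exists x y,
    [/\ v = src (shift x y a), half_turn (shift x y a) = shift x y a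
      & vertex_lattice a x y].
Proof.
have [x [y ->]] := vertex_shift_exists a v.
move/eqP/degree3P => fixed_xy; exists x, y; split=> //.
exact/half_turn_shift_fixed.
Qed.

Lemma degree3_base v :
  degree v = 3%N -> exists b,
    [/\ v = src b, cls b = cls a, half_turn b = b
      & has_basis (vertex_lattice b) m k s].
Proof.
move=> /degree3_shift[x [y [vE fixed_xy _]]]; exists (shift x y a).
by split; rewrite ?cls_shift //; apply: basis_shift.
Qed.

Lemma degree_base : degree (src a) = 3%N.
Proof. exact/eqP/degree3P. Qed.

(** Since [m] meets the specification, so does the epsilon choice; comparing both at one admissible
    vertex identifies them. [Kdist_eq] and [Splus_eq] follow the same pattern. *)
Lemma Mlen_eq : Mlen cls (cls a) = m.
Proof.
rewrite /Mlen; set P := fun _ => _.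
have Pm : P m.
  move=> v /degree3_base[b [-> <- fixed_b basis_b]].
  by rewrite (max_pathE fixed_b basis_b) size_mkseq.
have := epsilon_spec (inhabits 0%N) P (ex_intro _ m Pm) _ degree_base.
by rewrite (max_pathE half_turn_a basis_a) size_mkseq => <-.
Qed.

(** A vertex of degree 3 is [(i * s + j * m, i * k)]. Modulo twice the lattice only the parity of
    [i] matters for its row: even [i] gives the path of [a] itself, odd [i] a point at height
    [k]. *)
Lemma different_max_paths_shift C :
  different_max_paths cls (cls a) (src a) C -> exists j,
    let c := shift (s%:Z + j * m%:Z) k%:Z a in C = src c /\ half_turn c = c.
Proof.
have [_ _ _ basisE] := basis_a.
case=> _ /degree3_shift[x [y [-> fixed_c /basisE[i [j [xE yE]]]]]] diff.
have [i' [iE | iE]] : exists i', i = i' * 2 \/ i = i' * 2 + 1 :> int.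
- by exists (i %/ 2)%Z; lia.
- have cE : shift x y a = shift (j * m%:Z) 0 a.
    apply/shift_eqP; apply/(shift_fixedP half_turn_a basis_a).
    by exists i', 0; rewrite xE yE iE; split; ring.
  case: diff; rewrite (max_pathE half_turn_a basis_a).
  rewrite -(cls_shift x y) (max_pathE fixed_c (basis_shift x y)) cE.
  have fixed_c' : half_turn (shift (j * m%:Z) 0 a) = shift (j * m%:Z) 0 a.
    by rewrite -cE.
  apply/setP => d.
  apply/(straight_edgesP half_turn_a basis_a)/
        (straight_edgesP fixed_c' (basis_shift _ _)) => -[z ->].
    by exists (z - j * m%:Z); rewrite shiftD addrC subrK.
  by rewrite shiftD addr0; exists (j * m%:Z + z).
exists j; suff <- : shift x y a = shift (s%:Z + j * m%:Z) k%:Z a by [].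
apply/shift_eqP; apply/(shift_fixedP half_turn_a basis_a).
by exists i', 0; rewrite xE yE iE; split; ring.
Qed.

Lemma different_max_paths_base :
  different_max_paths cls (cls a) (src a) (src (shift s%:Z k%:Z a)).
Proof.
have [_ k_gt0 _ basisE] := basis_a.
have fixed_c : half_turn (shift s%:Z k%:Z a) = shift s%:Z k%:Z a.
  by apply/half_turn_shift_fixed => //; apply/basisE; exists 1, 0; lia.
split; [exact: degree_base | exact/eqP/degree3P | ].
rewrite (max_pathE half_turn_a basis_a) -(cls_shift s%:Z k%:Z).
rewrite (max_pathE fixed_c (basis_shift _ _)) => /setP/(_ (shift s%:Z k%:Z a)).
have -> : shift s%:Z k%:Z a \in path_edges (straight (shift s%:Z k%:Z a) m).
  apply/(straight_edgesP fixed_c (basis_shift _ _)).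
  by exists 0; rewrite shift0.
case/(straight_edgesP half_turn_a basis_a) => x /shift_eqP.
case/(shift_fixedP half_turn_a basis_a) => i [_ [_ E]].
have E' : k%:Z * (1 - i * 2) = 0.
  by rewrite mulrBr mulr1 -{1}(subr0 k%:Z) E; ring.
by move/eqP: E'; rewrite mulf_eq0; case: (k) k_gt0 => // k' _ /eqP; lia.
Qed.

(** A straight segment in the next class joins the rows 0 and [k] in [k] steps. Conversely, any walk
    between the two paths changes the ordinate by an odd multiple of [k]. *)
Lemma is_dist_max_paths C :
    different_max_paths cls (cls a) (src a) C ->
  is_dist (path_vertices (src a) (max_path cls (cls a) (src a)))
          (path_vertices C (max_path cls (cls a) C)) k.
Proof.
have [_ k_gt0 _ _] := basis_a.
move=> /different_max_paths_shift[j]; set x0 := _ + _ => -[-> fixed_c].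
rewrite (max_pathE half_turn_a basis_a) -(cls_shift x0 k%:Z).
rewrite (max_pathE fixed_c (basis_shift _ _)); split.
  exists (src (shift x0 0 a)), (straight (turn (shift x0 0 a)) k).
  rewrite size_mkseq -src_turn walk_straight last_straight; split=> //.
    apply/(straight_verticesP half_turn_a basis_a).
    by exists x0; rewrite src_turn.
  apply/(straight_verticesP fixed_c (basis_shift _ _)).
  exists 0; rewrite shift0 shift_turn src_turn shiftD oppr0.
  by rewrite addr0 add0r addr0.
move=> v p /(straight_verticesP half_turn_a basis_a)[x /esym src_v] wp.
have [x' [y' [-> le_y]]] := walk_bounded_shift src_v wp.
case/(straight_verticesP fixed_c (basis_shift _ _)) => x''.
rewrite !shiftD !add0r addr0; set X := x + x'; set X' := x0 + x''.
case/(src_shift_eqP half_turn_a) => /(shift_fixedP half_turn_a basis_a);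
  case=> i [_ [_ E]].
  have y'E : y' = (i * 2 + 1) * k%:Z by rewrite -(subrK k%:Z y') E; ring.
  rewrite -lez_nat; apply: le_trans le_y; rewrite y'E normrM.
  by apply: ler_peMl => //; lia.
have y'E : y' = (i * 2 - 1) * k%:Z by rewrite -(addrK k%:Z y') E; ring.
rewrite -lez_nat; apply: le_trans le_y; rewrite y'E normrM.
by apply: ler_peMl => //; lia.
Qed.

End Invariants.

Section Distance.

Variables (a : dart G) (m k s : nat).
Hypothesis half_turn_a : half_turn a = a.
Hypothesis basis_a : has_basis (vertex_lattice a) m k s.

Lemma Kdist_eq : Kdist cls (cls a) = k.
Proof.
rewrite /Kdist; set P := fun _ => _.
have Pk : P k.
  move=> A' C diff; have [A'3 _ _] := diff.
  have [b [A'E clsE fixed_b basis_b]] := degree3_base half_turn_a basis_a A'3.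
  by move: diff; rewrite A'E -clsE; apply: is_dist_max_paths fixed_b basis_b _.
have diff := different_max_paths_base half_turn_a basis_a.
have [[v [p [vX wp pY pK]]] le_K] :=
  epsilon_spec (inhabits 0%N) P (ex_intro _ k Pk) _ _ diff.
have [[v' [p' [v'X wp' p'Y p'k]]] le_k] := Pk _ _ diff.
apply/eqP; rewrite eqn_leq -{1}p'k -{2}pK.
by rewrite (le_K _ _ v'X wp' p'Y) (le_k _ _ vX wp pY).
Qed.

End Distance.

(** * Branches of a maximal path and their values *)

Section Branches.

Variables (a : dart G) (m k s : nat).
Hypothesis half_turn_a : half_turn a = a.
Hypothesis basis_a : has_basis (vertex_lattice a) m k s.

Let p := max_path cls (cls a) (src a).

Lemma src_shift_on_path x y :
  (src (shift x y a) \in path_vertices (src a) p) = ((2 * k)%N%:Z %| y)%Z.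
Proof.
rewrite /p (max_pathE half_turn_a basis_a).
apply/(straight_verticesP half_turn_a basis_a)/dvdzP => [[x' ] | [i ->]].
  case/(src_shift_eqP half_turn_a) => /(shift_fixedP half_turn_a basis_a);
    case=> i [_ [_ E]]; exists i; move: E; rewrite ?subr0 ?addr0 => ->;
    rewrite PoszM; ring.
exists (x - i * s%:Z * 2); congr src; apply/shift_eqP.
apply/(shift_fixedP half_turn_a basis_a).
by exists i, 0; rewrite PoszM; split; ring.
Qed.

Lemma turn_shift_adjacent x y :
  adjacent_edge (src a) p (turn (shift x y a)) =
  ((2 * k)%N%:Z %| y)%Z || ((2 * k)%N%:Z %| y + 1)%Z.
Proof.
rewrite /adjacent_edge tgtE forward_turn sidewaysE shiftD !src_turn.
rewrite !src_shift_on_path /p (max_pathE half_turn_a basis_a).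
case: (straight_edgesP half_turn_a basis_a) => // -[z /(congr1 cls)].
rewrite cls_turn !cls_shift => /eqP; rewrite -subr_eq0 addrC addKr => /eqP.
by move/(congr1 val).
Qed.

Lemma away_src_on_path x y (i : int) :
    y = i * (2 * k)%N%:Z ->
  away (src a) p (turn (shift x y a)) = turn (shift (x - i * s%:Z * 2) 0 a).
Proof.
move=> yE; rewrite /away src_turn src_shift_on_path.
rewrite (_ : (_ %| y)%Z); last by apply/dvdzP; exists i.
congr (turn _); apply/shift_eqP; apply/(shift_fixedP half_turn_a basis_a).
by exists i, 0; rewrite yE PoszM; split; ring.
Qed.

Lemma away_tgt_on_path x y (i : int) :
    y + 1 = i * (2 * k)%N%:Z ->
  away (src a) p (turn (shift x y a)) = turn (shift (i * s%:Z * 2 - x) 0 a).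
Proof.
have [_ k_gt0 _ _] := basis_a.
move=> yE; rewrite /away src_turn src_shift_on_path.
(* If both ends were on the path, [2 * k] would divide 1. *)
case: dvdzP => [[j yE'] | _].
  have E : (i - j) * (2 * k)%N%:Z = 1 by rewrite mulrBl -yE -yE' addrC addKr.
  have : ((2 * k)%N%:Z %| 1)%Z by apply/dvdzP; exists (i - j).
  by rewrite dvdz1 /= => /eqP; lia.
rewrite flipE forward_turn sidewaysE shiftD half_turn_turn addr0 yE.
rewrite half_turn_shift_base //; congr (turn _).
apply/shift_eqP; apply/(shift_fixedP half_turn_a basis_a).
by exists (- i), 0; rewrite PoszM; split; ring.
Qed.

Lemma foot_turn_shift d (z : nat) :
    (z < 2 * m)%N -> away (src a) p d = turn (shift z%:Z 0 a) ->
  foot (src a) p d = if (z < m)%N then z else (2 * m - z)%N.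
Proof.
move=> lt_z away_d; rewrite /foot away_d src_turn.
have uniq_p : uniq (path_vertices (src a) p).
  rewrite /p (max_pathE half_turn_a basis_a).
  by rewrite (straight_uniq half_turn_a basis_a).
have size_p : size (path_vertices (src a) p) = m.+1.
  by rewrite /p (max_pathE half_turn_a basis_a) straight_vertices size_mkseq.
have nth_p j : (j <= m)%N ->
    nth (src a) (path_vertices (src a) p) j = src (shift j%:Z 0 a).
  move=> le_jm; rewrite /p (max_pathE half_turn_a basis_a) straight_vertices.
  by rewrite nth_mkseq.
case: ltnP => [lt_zm | le_mz].
  by rewrite -nth_p 1?ltnW // index_uniq // size_p ltnS ltnW.
have -> : src (shift z%:Z 0 a) = src (shift (2 * m - z)%N%:Z 0 a).
  by apply/(src_forward_eqP half_turn_a basis_a); right; exists 1; lia.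
by rewrite -nth_p ?index_uniq ?size_p //; lia.
Qed.

(** For [z < m] the branch follows counterclockwise a dart of the path, for [z >= m] the reversal of
    one. The second clause of [left_branch] never applies, because [turn] takes a branch of class
    [q + 1] to class [q + 2]. *)
Lemma left_branch_turn_shift d (z : nat) :
    (z < 2 * m)%N -> away (src a) p d = turn (shift z%:Z 0 a) ->
  left_branch (src a) p d = (z < m)%N.
Proof.
move=> lt_z away_d; have [m_gt0 _ _ _] := basis_a.
rewrite /left_branch (foot_turn_shift lt_z away_d) away_d.
have size_p : size p = m.
  by rewrite /p (max_pathE half_turn_a basis_a) size_mkseq.
have nth_p e j : (j < m)%N -> nth e p j = shift j%:Z 0 a.
  by move=> lt_jm; rewrite /p (max_pathE half_turn_a basis_a) nth_mkseq.
rewrite size_p; case: (ltnP z m) => [lt_zm | le_mz].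
  by rewrite lt_zm nth_p // eqxx.
apply/norP; split; apply/negP => /andP[lt_j /eqP].
  rewrite nth_p // => /perm_inj/shift_eqP; rewrite subrr.
  case/(forward_fixedP half_turn_a basis_a) => l E.
  have m2_gt0 : (0 < (2 * m)%N%:Z)%R by lia.
  have l_lt0 : l < 0 by rewrite -(ltr_pM2r m2_gt0) -E; lia.
  have l_gt : -1 < l by rewrite -(ltr_pM2r m2_gt0) -E; lia.
  by lia.
rewrite nth_p; last by lia.
move/(congr1 cls); rewrite cls_flip !cls_turn !cls_shift => /eqP.
by rewrite -addrA -subr_eq0 addrC addrK => /eqP /(congr1 val).
Qed.

(** Counting right branches down from [2 * m] undoes the reflection of the foot at the far end, so
    the value is the position on the line modulo its period. *)
Lemma branch_value_turn_shift d x :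
    away (src a) p d = turn (shift x 0 a) ->
  (branch_value cls (cls a) (src a) d)%:Z = (x %% (2 * m)%N%:Z)%Z.
Proof.
have [z [lt_z <- ->]] := forward_shift_mod half_turn_a basis_a x.
move=> away_d; congr Posz; rewrite /branch_value -/p.
rewrite (left_branch_turn_shift lt_z away_d) (foot_turn_shift lt_z away_d).
rewrite (Mlen_eq half_turn_a basis_a); case: ltnP => // le_mz.
by rewrite subKn // ltnW.
Qed.

Lemma left_branch_lt d x :
    away (src a) p d = turn (shift x 0 a) ->
  left_branch (src a) p d = (branch_value cls (cls a) (src a) d < m)%N.
Proof.
have [z [lt_z zE xE]] := forward_shift_mod half_turn_a basis_a x.
move=> away_d; have := branch_value_turn_shift away_d; rewrite -zE => -[->].
by rewrite xE in away_d; apply: left_branch_turn_shift.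
Qed.

(* Every stretch of k successive edges of class q + 1 between two paths of
   class q has exactly one edge adjacent to [A, q]: the first or the last one,
   according to the parity of the stretch. *)
Lemma adjacent_block x (i : int) :
  let f r := turn (shift x (i * k%:Z + r%:Z) a) in
  [seq d <- mkseq f k | adjacent_edge (src a) p d] =
  [:: f (if (2 %| i)%Z then 0%N else k.-1)].
Proof.
have [_ k_gt0 _ _] := basis_a.
move=> f; rewrite /mkseq filter_map.
set r0 := if _ then _ else _.
have lt_r0 : (r0 < k)%N by rewrite /r0; case: ifP; lia.
suff -> : [seq r <- iota 0 k | preim f (adjacent_edge (src a) p) r] = [:: r0].
  by [].
rewrite -(@filter_pred1_uniq _ (iota 0 k) r0) ?iota_uniq ?mem_iota //.
apply: eq_in_filter => r; rewrite mem_iota add0n => /andP[_ lt_rk] /=.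
rewrite turn_shift_adjacent.
have m2_gt0 : (0 < (2 * k)%N%:Z)%R by lia.
have [j iE] : exists j, i = j * 2 \/ i = j * 2 + 1 by exists (i %/ 2)%Z; lia.
have dvdE (b : int) : 0 <= b -> b <= (2 * k)%N%:Z ->
    ((2 * k)%N%:Z %| j * (2 * k)%N%:Z + b)%Z = (b == 0) || (b == (2 * k)%N%:Z).
  move=> b_ge0 b_le; apply/dvdzP/orP => [[l' /(canRL (addKr _))] | [] /eqP ->].
  - rewrite addrC -mulrBl; move: (l' - j) => l bE.
    have l_lt : l < 2 by rewrite -(ltr_pM2r m2_gt0) -bE; lia.
    have l_gt : -1 < l by rewrite -(ltr_pM2r m2_gt0) -bE; lia.
    have [l0 | l1] : l = 0 \/ l = 1 by lia.
      by left; rewrite bE l0 mul0r.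
    by right; rewrite bE l1 mul1r.
  - by exists j; rewrite addr0.
  - by exists (j + 1); rewrite mulrDl mul1r.
rewrite /r0; case: iE => iE.
  have -> : i * k%:Z + r%:Z = j * (2 * k)%N%:Z + r%:Z.
    by rewrite iE PoszM; ring.
  rewrite -addrA !dvdE; [|lia..].
  rewrite (_ : (2 %| i)%Z); last by apply/dvdzP; exists j.
  by rewrite /=; lia.
have -> : i * k%:Z + r%:Z = j * (2 * k)%N%:Z + (k + r)%N%:Z.
  by rewrite iE !PoszM PoszD; ring.
rewrite -addrA !dvdE; [|lia..].
rewrite (_ : (2 %| i)%Z = false); last by apply/negP => /dvdzP[l]; lia.
by rewrite /=; lia.
Qed.

End Branches.

(** * The path of the next class and its adjacent edges *)

Section NextClass.

Variables (a : dart G) (m k s : nat).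
Hypothesis half_turn_a : half_turn a = a.
Hypothesis basis_a : has_basis (vertex_lattice a) m k s.

Lemma next_class_basis :
  exists s', has_basis (vertex_lattice (turn a))
               (m %/ gcdn s m * k)%N (gcdn s m) s'.
Proof.
have [m' [k' [s' basis_t]]] := vertex_lattice_basis (turn a).
have [|<- mE] := @rotated_basis (vertex_lattice a) m k s m' k' s' basis_a.
  have [m'_gt0 k'_gt0 lt_s' basisE] := basis_t.
  by split=> // x y; rewrite -basisE vertex_lattice_turn.
by exists s'; rewrite mulnC -mE.
Qed.

Lemma max_path_next x y :
    half_turn (shift x y a) = shift x y a ->
  max_path cls (cls a + 1) (src (shift x y a)) =
  mkseq (fun r => turn (shift x (y + r%:Z) a)) (m %/ gcdn s m * k).
Proof.
move=> fixed_c; have [s' [m'_gt0 k'_gt0 lt_s' basisE]] := next_class_basis.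
rewrite -(cls_shift x y) -cls_turn -src_turn.
rewrite (@max_pathE _ (m %/ gcdn s m * k) (gcdn s m) s').
- by apply: eq_map => r; rewrite shift_turn shiftD oppr0 !addr0.
- by rewrite half_turn_turn fixed_c.
split=> // x' y'; rewrite -basisE !vertex_lattice_turn.
exact: vertex_lattice_shift.
Qed.

(** Ordinate of the source of the one adjacent edge in the [i]-th stretch of [k] edges, as found in
    [adjacent_block]. *)
Definition adjacent_position (i : int) : int :=
  i * k%:Z + (if (2 %| i)%Z then 0%N else k.-1)%:Z.

(** The path consists of [m %/ gcdn s m] stretches of [k] edges, each contributing one adjacent
    edge. *)
Lemma adjacent_edges_next x (i : int) :
    half_turn (shift x (i * k%:Z) a) = shift x (i * k%:Z) a ->
  adjacent_edges cls (cls a) (src a) (src (shift x (i * k%:Z) a)) =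
  mkseq (fun b => turn (shift x (adjacent_position (i + b%:Z)) a))
        (m %/ gcdn s m).
Proof.
move=> fixed_c; rewrite /adjacent_edges max_path_next //.
elim: (m %/ gcdn s m)%N => [|n IHn] //.
rewrite mulSn addnC mkseqD filter_cat IHn mkseqS -cats1; congr (_ ++ _).
have := adjacent_block half_turn_a basis_a x (i + n%:Z).
rewrite /= -/(adjacent_position _) => <-; congr (filter _ _).
by apply: eq_map => r; congr (turn (shift _ _ _)); rewrite PoszD PoszM; ring.
Qed.

(** The half turn about [a] moves [C] from [(x, k)] to [(- x, - k)], where [x = s + j * m]. The
    first stretch, of odd index -1, ends on the row of [a]; its last edge, seen from the path, sits
    at [x] modulo [2 * m]. This is [s] on the left or [s + m] on the right. *)
Lemma first_branch C :
    different_max_paths cls (cls a) (src a) C ->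
  exists2 f, ohead (adjacent_edges cls (cls a) (src a) C) = Some f &
    s = if left_branch (src a) (max_path cls (cls a) (src a)) f
        then branch_value cls (cls a) (src a) f
        else (branch_value cls (cls a) (src a) f - Mlen cls (cls a))%N.
Proof.
have [m_gt0 k_gt0 lt_sm _] := basis_a.
case/(different_max_paths_shift half_turn_a basis_a) => j [-> fixed_c].
set x := s%:Z + _ in fixed_c *.
have cE : shift x k%:Z a = shift (- x) (-1 * k%:Z) a.
  by rewrite -fixed_c half_turn_shift_base // mulN1r.
rewrite cE adjacent_edges_next -?cE //.
have -> : (m %/ gcdn s m)%N = (m %/ gcdn s m).-1.+1.
  by rewrite prednK // divn_gt0 ?gcdn_gt0 ?m_gt0 ?orbT // dvdn_leq ?dvdn_gcdr.
rewrite /mkseq /=.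
exists (turn (shift (- x) (adjacent_position (-1 + 0)) a)) => //.
set f := turn _.
have away_f :
    away (src a) (max_path cls (cls a) (src a)) f = turn (shift x 0 a).
  have yE : adjacent_position (-1 + 0) + 1 = 0 * (2 * k)%N%:Z.
    by rewrite /adjacent_position /=; lia.
  rewrite (away_tgt_on_path half_turn_a basis_a _ yE).
  by rewrite !mul0r sub0r opprK.
rewrite (left_branch_lt half_turn_a basis_a away_f).
rewrite (Mlen_eq half_turn_a basis_a).
have := branch_value_turn_shift half_turn_a basis_a away_f.
move: (branch_value _ _ _ _) => v vE.
have m_gt0' : (0 < m%:Z)%R by lia.
have m2_gt0 : (0 < (2 * m)%N%:Z)%R by lia.
have v_lt : (v < 2 * m)%N by rewrite -ltz_nat vE ltz_pmod.
have {}vE : v%:Z = s%:Z + (j - 2 * (x %/ (2 * m)%N%:Z)%Z) * m%:Z.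
  rewrite vE; apply: (addrI ((x %/ (2 * m)%N%:Z)%Z * (2 * m)%N%:Z)).
  by rewrite -divz_eq /x PoszM; ring.
move: (j - _) vE => l vE; have l_lt : l < 2.
  by rewrite -(ltr_pM2r m_gt0'); lia.
have l_gt : -1 < l by rewrite -(ltr_pM2r m_gt0'); lia.
have [l0 | l1] : l = 0 \/ l = 1 by lia.
  by case: ltnP; subst l; lia.
by case: ltnP; subst l; lia.
Qed.

End NextClass.

(** * The value of [Splus] and the billiard sequence *)

Section Conclusion.

Variables (a : dart G) (m k s : nat).
Hypothesis half_turn_a : half_turn a = a.
Hypothesis basis_a : has_basis (vertex_lattice a) m k s.

Lemma Splus_eq : Splus cls (cls a) = s.
Proof.
rewrite /Splus; set P := fun _ => _.
have Ps : P s.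
  move=> A' C diff; have [A'3 _ _] := diff.
  have [b [A'E clsE fixed_b basis_b]] := degree3_base half_turn_a basis_a A'3.
  by move: diff; rewrite A'E -clsE; apply: first_branch fixed_b basis_b _.
have diff := different_max_paths_base half_turn_a basis_a.
have [f fE ->] := epsilon_spec (inhabits 0%N) P (ex_intro _ s Ps) _ _ diff.
by have [f' + ->] := Ps _ _ diff; rewrite fE => -[->].
Qed.

Lemma adjacent_edges_base :
  adjacent_edges cls (cls a) (src a) (src a) =
  mkseq (fun b => turn (shift 0 (adjacent_position k b%:Z) a))
        (m %/ gcdn s m).
Proof.
have aE : shift 0 (0 * k%:Z) a = a by rewrite mul0r shift0.
have := adjacent_edges_next half_turn_a basis_a (x := 0) (i := 0).
by rewrite aE => ->.
Qed.

(** For even [b] the edge starts on the path, at position [- 2 * b./2 * s]; for odd [b] it ends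
    there and is reversed, giving [2 * (b./2 + 1) * s]. The index [b] counts from 0 and the billiard
    sequence from 1. *)
Lemma branch_value_adjacent_edges b :
    (b < m %/ gcdn s m)%N ->
  let values := map (branch_value cls (cls a) (src a))
                    (adjacent_edges cls (cls a) (src a) (src a)) in
  (nth 0%N values b)%:Z = 2 * billiard_num m s b.+1.
Proof.
move=> lt_b /=; rewrite adjacent_edges_base (nth_map a) ?size_mkseq //.
rewrite nth_mkseq //.
have k_gt0 : (0 < k)%N by case: basis_a.
have m2 z : 2 * (z %% m%:Z)%Z = ((2 * z) %% (2 * m)%N%:Z)%Z :> int.
  by rewrite mulz_modr // PoszM.
have bE := odd_double_half b; rewrite /billiard_num /= uphalf_half.
case: (odd b) bE => bE; rewrite /= m2.
  have yE : adjacent_position k b%:Z + 1 = (b./2.+1)%:Z * (2 * k)%N%:Z.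
    rewrite /adjacent_position (_ : (2 %| b%:Z)%Z = false); last first.
      by apply/negP => /dvdzP[l]; lia.
    by nia.
  have away_b := away_tgt_on_path half_turn_a basis_a 0 yE.
  rewrite (branch_value_turn_shift half_turn_a basis_a away_b) subr0.
  by congr (_ %% _)%Z; lia.
have yE : adjacent_position k b%:Z = (b./2)%:Z * (2 * k)%N%:Z.
  rewrite /adjacent_position (_ : (2 %| b%:Z)%Z); last first.
    by apply/dvdzP; exists (Posz b./2); lia.
  by nia.
have away_b := away_src_on_path half_turn_a basis_a 0 yE.
rewrite (branch_value_turn_shift half_turn_a basis_a away_b) sub0r.
by congr (_ %% _)%Z; lia.
Qed.

End Conclusion.

Lemma degree3_class_dart v q :
  degree v = 3%N -> exists a, [/\ src a = v, cls a = q & half_turn a = a].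
Proof.
move=> v3; have /card_gt0P[d /eqP src_d] : (0 < degree v)%N by rewrite v3.
(* Each turn raises the class by 1, so [q - cls d] turns lead to class [q]. *)
exists ((turn ^+ (q - cls d)%R)%g d); rewrite src_turnX cls_turnX natr_Zp.
split=> //; first by rewrite addrC subrK.
by apply/degree3P; rewrite src_turnX src_d v3.
Qed.

End Translations.

Theorem theorem3p1 (R : realFieldType) (G : rotation_graph)
    (cls : dart G -> 'Z_3) (q : 'Z_3) (A : vertex G) :
  family_P G -> edge_classes cls -> degree A = 3 ->
  let es := adjacent_edges cls q A A in
  let n := size es in
  let values := map (branch_value cls q A) es in
  let M := Mlen cls in
  let K := Kdist cls in
  let S := Splus cls q in
  [/\ 1 < n ->
        exists2 F : nat -> R,
          billiard_sequence (S%:R / (M q)%:R)%R F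
          & forall j, 1 <= j <= n ->
              ((nth 0%N values j.-1)%:R = (2 * M q)%:R * F j)%R,
      n = M q %/ gcdn S (M q),
      K (q + 1)%R = gcdn S (M q)
    & K (q + 1)%R * M (q + 1)%R = K q * M q].
Proof.
move=> [[P_connected _] _ _ P_triangulation P_degree] [cls_flip cls_turn] A3.
have [a [<- <- fixed_a]] := degree3_class_dart P_degree cls_turn q A3.
have [m [k [s basis_a]]] :=
  vertex_lattice_basis P_triangulation P_degree a.
have [m_gt0 _ lt_sm _] := basis_a.
have [s' basis_t] := next_class_basis P_triangulation P_degree basis_a.
have fixed_t : half_turn G (turn a) = turn a by rewrite half_turn_turn fixed_a.
move=> es n values M K S.
have -> : M (cls a) = m by apply: Mlen_eq basis_a.
have -> : S = s by apply: Splus_eq basis_a.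
have -> : K (cls a) = k by apply: Kdist_eq basis_a.
have -> : M (cls a + 1)%R = m %/ gcdn s m * k.
  by rewrite -cls_turn; apply: Mlen_eq basis_t.
have -> : K (cls a + 1)%R = gcdn s m.
  by rewrite -cls_turn; apply: Kdist_eq basis_t.
have nE : n = m %/ gcdn s m.
  have := adjacent_edges_base P_triangulation P_degree cls_flip cls_turn
    fixed_a basis_a.
  by rewrite /n /es => ->; rewrite size_mkseq.
split=> //; last by rewrite mulnA (mulnC (gcdn s m)) divnK ?dvdn_gcdr // mulnC.
(* A billiard sequence needs a positive ratio; [s = 0] would give [gcdn s m = m] and a single
   adjacent edge. *)
rewrite nE => n_gt1; have s_gt0 : 0 < s.
  by rewrite lt0n; apply: contraTneq n_gt1 => ->; rewrite gcd0n divnn m_gt0.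
exists (fun j => (billiard_num m s j)%:~R / m%:R)%R.
  by apply: billiard_num_sequence; rewrite s_gt0.
case=> // b /= lt_b.
have E := branch_value_adjacent_edges P_triangulation P_degree cls_flip cls_turn
  P_connected fixed_a basis_a lt_b.
have m_neq0 : (m%:R != 0 :> R)%R by rewrite pnatr_eq0 -lt0n.
rewrite -[LHS]/((nth 0 values b)%:Z%:~R)%R E intrM natrM.
by rewrite mulrACA divff // mulr1.
Qed.
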